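(* Let $j\ge 1$ be fixed and let $p\in\{1,\dots,7\}$. Let $\lambda_j$ be the $j$-th exact eigenvalue of $-\Delta u=\lambda u$ in $\Omega=(0,1)^d$ with $u=0$ on $\partial\Omega$, and let $\tilde\lambda_j^h$ be the corresponding approximate eigenvalue of the $p$-th order maximum-continuity isogeometric discretization with the optimally blended quadrature rule $O_p$. Assume $\tilde\lambda_j^h=\tilde\lambda^{p,h}_{O_p}$, where $\tilde\lambda^{p,h}_{O_p}$ is the value determined by the discrete dispersion relation of the scheme at $\lambda=\lambda_j$. Then there is a constant $C$ independent of $h$ such that for every $h$ with $\max\{\sqrt{\lambda_j}\,h,\ \sqrt{\tilde\lambda_j^h}\,h\}<1$, $$|\tilde\lambda_j^h-\lambda_j|\le C\,h^{2p+2}\,\lambda_j^{p+2}.$$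
   Context: **Continuous problem.** Let $d\in\{1,2,3\}$, $\Omega=(0,1)^d$. The exact eigenpairs $(\lambda_j,u_j)$, $u_j\in H^1_0(\Omega)$, satisfy $a(u_j,v)=\lambda_j b(u_j,v)$ for all $v\in H_0^1(\Omega)$, where $a(w,v)=\int_\Omega\nabla w\cdot\nabla v$ and $b(w,v)=\int_\Omega wv$; eigenvalues are listed with multiplicity, $0<\lambda_1<\lambda_2\le\lambda_3\le\cdots$. **Mesh and space.** For positive integers $N_1,\dots,N_d$ put $h_k=1/N_k$; $\overline\Omega$ carries the uniform tensor-product mesh $\mathcal T_h$ with $\prod_k N_k$ elements with nodes $(h_1n_1,\dots,h_dn_d)$, $0\le n_k\le N_k$, and $h=\sqrt{\sum_k h_k^2}$ (for $d=1$, $h=h_1$). $V_h\subset H_0^1(\Omega)$ is spanned by tensor products of one-dimensional B-splines of degree $p$ on this mesh with non-repeated knots (maximum continuity $C^{p-1}$). **Quadrature.** In one dimension $G_m$ and $GL_m$ denote the $m$-point Gauss–Legendre and Gauss–Lobatto rules, mapped affinely to each element. Linear combinations $\tau\mathcal Q_1+(1-\tau)\mathcal Q_2$ of rules are called blended rules; in several dimensions the tensor product of the one-dimensional rule is used. The optimally blended rule $O_p$ is: - $p=1$: $\tfrac12G_2+\tfrac12GL_2$; - $p=2$: $\tfrac13G_3+\tfrac23GL_3$ (equivalently $2G_3-G_2$); - $p=3$: $-\tfrac32G_4+\tfrac52GL_4$ (equivalently $\tfrac{13}{3}G_4-\tfrac{10}{3}G_3$); - $p=4$: $-\tfrac{79}{5}G_5+\tfrac{84}{5}GL_5$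 (equivalently $22G_5-21G_4$); - $p=5$: $-174G_6+175GL_6$ (equivalently $211G_6-210G_5$); - $p=6$: $-\tfrac{91177}{35}G_7+\tfrac{91212}{35}GL_7$ (equivalently $\tfrac{30414}{10}G_7-\tfrac{30404}{10}G_6$); - $p=7$: $-\tfrac{105103}{2}G_8+\tfrac{105105}{2}GL_8$ (equivalently $60061G_8-60060G_7$). **Discrete problem.** $\tilde a_h,\tilde b_h$ are $a,b$ with the integral over each element replaced by the rule $O_p$. The approximate eigenpairs $(\tilde\lambda_j^h,\tilde u_j^h)$, $\tilde u_j^h\in V_h$, satisfy $\tilde a_h(\tilde u_j^h,v_h)=\tilde\lambda_j^h\,\tilde b_h(\tilde u_j^h,v_h)$ for all $v_h\in V_h$; they are sorted in ascending order and paired with the exact ones. **Discrete dispersion relation and $\tilde\lambda^{p,h}_{O_p}$.** For $d=1$, consider the equation of the discrete problem at a node away from the boundary and insert coefficients $U^a=e^{ia\Lambda}$, where $\Lambda=\sqrt{\lambda}\,h$. Explicitly, let $B$ be the cardinal B-spline of degree $p$ with integer knots, supported on $[0,p+1]$, and let $k_m$, $m_m$ ($|m|\le p$) be the values of $\int_{\mathbb R}B'(x)B'(x-m)\,dx$ and $\int_{\mathbb R}B(x)B(x-m)\,dx$ computed with the rule $O_p$ on each unit interval between consecutive integers. The value determined by the dispersion relation is $$\tilde\lambda^{p,h}_{O_p}=\frac1{h^2}\,\frac{\sum_{|m|\le p}k_m\cos(m\Lambda)}{\sum_{|m|\le p}m_m\cos(m\Lambda)},\qquad \Lambda=\sqrt\lambda\,h.$$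 For instance, for $p=2$: $\tilde\lambda^{2,h}_{O_2}h^2=\dfrac{120(2-\cos\Lambda-\cos^2\Lambda)}{97+76\cos\Lambda+7\cos^2\Lambda}$. For $d>1$, write $\lambda_j=\sum_{k=1}^d\lambda^{(k)}$ with $\lambda^{(k)}=\pi^2m_k^2$ ($m_k\ge1$ integers) the one-dimensional eigenvalues; then $\tilde\lambda^{p,h}_{O_p}$ is the sum over $k$ of the one-dimensional values obtained from $\lambda^{(k)}$ with mesh size $h_k$. *)

(* Defs.v *)
From HB Require Import structures.
From mathcomp Require Import all_boot all_order all_algebra.
From mathcomp Require Import polyrcf.
From mathcomp Require Import all_classical all_reals all_analysis.

Set Implicit Arguments.
Unset Strict Implicit.
Unset Printing Implicit Defensive.

Import Order.TTheory GRing.Theory Num.Theory.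
Import numFieldNormedType.Exports.

Local Open Scope classical_set_scope.
Local Open Scope ring_scope.

(* All eigenpairs of a problem posed on functions T -> R (taken modulo [null]),
   listed in ascending order and with multiplicity, the indices being the i
   with [I i].  By the last clause every eigenvector with eigenvalue mu is a
   combination of listed ones with that same eigenvalue, so nothing is
   missing from the list. *)
Definition eigen_listing (R : realType) (T : Type) (null : (T -> R) -> Prop)
    (eigenpair : R -> (T -> R) -> Prop) (I : pred nat)
    (lam : nat -> R) (u : nat -> T -> R) : Prop :=
  [/\ forall i, I i -> eigenpair (lam i) (u i),
      forall i i', I i -> I i' -> (i <= i')%N -> lam i <= lam i',
      forall (n : nat) (c : nat -> R),
        null (fun x => \sum_(0 <= i < n | I i) c i * u i x) ->
        forall i, (i < n)%N -> I i -> c i = 0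
    & forall mu w, eigenpair mu w -> exists (n : nat) (c : nat -> R),
        null (fun x =>
          w x - \sum_(0 <= i < n | I i && (lam i == mu)) c i * u i x)].

Section tuple_lebesgue.
Context (R : realType).

Definition tuple_cons (d : nat) (z : d.-tuple R * R) : d.+1.-tuple R :=
  [tuple of z.2 :: z.1].

Lemma measurable_tuple_cons (d : nat) : measurable_fun setT (@tuple_cons d).
Proof.
exact: (measurable_cons (@measurable_snd _ _ _ _) (@measurable_fst _ _ _ _)).
Qed.

Definition prepend (d : nat) (m : {measure set (d.-tuple R) -> \bar R}) :
    set (d.+1.-tuple R) -> \bar R :=
  pushforward (m \x (@lebesgue_measure R))%E (@tuple_cons d).

HB.instance Definition _ d m := Measure.copy (@prepend d m)
  (measure_function_pushforward__canonical__measure_function_Measure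
    (m \x (@lebesgue_measure R))%E (@measurable_tuple_cons d)).

(* Lebesgue measure on R^d, as an iterated product of Lebesgue measures on R. *)
Fixpoint lebesgue_tuple (d : nat) : {measure set (d.-tuple R) -> \bar R} :=
  match d with
  | 0 => \d_[tuple]
  | d'.+1 => prepend (lebesgue_tuple d')
  end.

End tuple_lebesgue.

Section exact_problem.
Context (R : realType) (d : nat).
Local Notation E := (d.-tuple R).
Local Notation mu := (@lebesgue_tuple R d).

Definition vec (x : E) : 'rV[R]_d := \row_k tnth x k.

Definition cube : set E := [set x | forall k, 0 < tnth x k < 1].

Definition partial (k : 'I_d) (f : 'rV[R]_d -> R) : 'rV[R]_d -> R :=
  fun x => 'D_(delta_mx 0 k) f x.

Fixpoint Cn (n : nat) (f : 'rV[R]_d -> R) : Prop :=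
  match n with
  | 0 => continuous f
  | n'.+1 => (forall x, differentiable f x) /\ (forall k, Cn n' (partial k f))
  end.

(* Membership in C_c^oo((0,1)^d), for functions extended by 0 to R^d. *)
Definition test_function (f : 'rV[R]_d -> R) : Prop :=
  (forall n, Cn n f) /\
  exists K : set 'rV[R]_d, [/\ compact K,
    forall x, K x -> forall k, 0 < x 0 k < 1
    & forall x, ~ K x -> f x = 0].

Definition L2 (f : E -> R) : Prop :=
  measurable_fun cube f /\ (\int[mu]_(x in cube) ((f x) ^+ 2)%:E < +oo)%E.

Definition cvg_L2 (f : nat -> E -> R) (g : E -> R) : Prop :=
  (fun n => (\int[mu]_(x in cube) ((f n x - g x) ^+ 2)%:E)%E) @ \oo --> 0%E.

(* u belongs to H^1_0((0,1)^d), the closure of C_c^oo in the H^1 norm, and has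
   weak gradient g (which is determined by u up to null sets). *)
Definition H10 (u : E -> R) (g : 'I_d -> E -> R) : Prop :=
  [/\ L2 u, forall k, L2 (g k)
    & exists phi : nat -> 'rV[R]_d -> R,
      [/\ forall n, test_function (phi n),
          cvg_L2 (fun n => phi n \o vec) u
        & forall k, cvg_L2 (fun n => partial k (phi n) \o vec) (g k)]].

Definition ae_zero (u : E -> R) : Prop :=
  {ae mu, forall x, cube x -> u x = 0}.

Definition form_a (g gv : 'I_d -> E -> R) : R :=
  \int[mu]_(x in cube) (\sum_(k < d) g k x * gv k x).

Definition form_b (u v : E -> R) : R := \int[mu]_(x in cube) (u x * v x).

Definition exact_eigenpair (lam : R) (u : E -> R) : Prop :=
  ~ ae_zero u /\
  exists g, H10 u g /\
    forall v gv, H10 v gv -> form_a g gv = lam * form_b u v.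

Definition exact_eigen_listing : (nat -> R) -> (nat -> E -> R) -> Prop :=
  eigen_listing ae_zero exact_eigenpair (fun i => 1 <= i)%N.

End exact_problem.

Section quadrature.
Context (R : realType).

Definition rule := seq (R * R).

Definition legendre (m : nat) : {poly R} :=
  (2 ^+ m * m`!%:R)^-1 *: (('X^2 - 1) ^+ m)^`(m).

Definition lagrange_basis (s : seq R) (x : R) : {poly R} :=
  \prod_(y <- s | y != x) ((x - y)^-1 *: ('X - y%:P)).

Definition interpolatory_rule (s : seq R) : rule :=
  [seq (x, \int[lebesgue_measure]_(t in `[-1, 1]) (lagrange_basis s x).[t])
     | x <- s].

Definition gauss_legendre (m : nat) : rule :=
  interpolatory_rule (rootsR (legendre m)).

Definition gauss_lobatto (m : nat) : rule :=
  interpolatory_rule (-1 :: rcons (rootsR ((legendre m.-1)^`())) 1).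

Definition blend (tau : R) (Q1 Q2 : rule) : rule :=
  [seq (z.1, tau * z.2) | z <- Q1] ++ [seq (z.1, (1 - tau) * z.2) | z <- Q2].

(* 0 is a placeholder outside the range 1 <= p <= 7.  The last two numerators
   are 91177 and 105103, too large for unary literals. *)
Definition opt_tau (p : nat) : R :=
  match p with
  | 1 => 1 / 2
  | 2 => 1 / 3
  | 3 => - (3 / 2)
  | 4 => - (79 / 5)
  | 5 => - 174
  | 6 => - ((91 * 10 ^+ 3 + 177) / 35)
  | 7 => - ((105 * 10 ^+ 3 + 103) / 2)
  | _ => 0
  end.

Definition opt_rule (p : nat) : rule :=
  blend (opt_tau p) (gauss_legendre p.+1) (gauss_lobatto p.+1).

(* The rule is mapped affinely from [-1, 1] to [a, a + h]. *)
Definition node_on (Q : rule) (a h : R) (q : nat) : R :=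
  a + h * (1 + (nth (0, 0) Q q).1) / 2.
Definition weight_on (Q : rule) (h : R) (q : nat) : R :=
  h / 2 * (nth (0, 0) Q q).2.

End quadrature.

(* The polynomial that the i-th B-spline of degree p with knots t coincides
   with on the nonempty knot span (t k, t (k + 1)), by the Cox-de Boor
   recursion; the convention 0 / 0 = 0 for repeated knots is built in, as
   0^-1 = 0.  Working with the pieces gives derivatives at the end points of
   an element their one-sided value from inside that element, which is what
   an element-wise quadrature uses. *)
Fixpoint bspline (R : realType) (t : int -> R) (p : nat) (i k : int) : {poly R}
    :=
  match p with
  | 0 => (i == k)%:R
  | q.+1 =>
      (t (i + q%:Z + 1) - t i)^-1 *: (('X - (t i)%:P) * bspline t q i k) +
      (t (i + q%:Z + 2) - t (i + 1))^-1 *: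
        (((t (i + q%:Z + 2))%:P - 'X) * bspline t q (i + 1) k)
  end.

(* Open knot vector of the uniform mesh with N elements of [0, 1]: the interior
   knots i / N are simple, 0 and 1 are repeated. Element e is the span number
   e, and the B-splines with support in [0,1] are those with -p <= i <= N - 1. *)
Definition open_knot (R : realType) (N : nat) (i : int) : R :=
  (Num.min (Num.max i 0) N%:Z)%:~R / N%:R.

Section discrete_problem.
Context (R : realType) (d p : nat) (N : 'I_d -> nat).

(* In one direction, the B-splines number -p and N - 1, the only ones not
   vanishing at 0 and 1, are dropped, so N + p - 2 of them remain, the s-th one
   having number s - p + 1.  Their tensor products form a basis of V_h, whose
   elements are represented by their coefficients. *)
Definition dof := {dffun forall k : 'I_d, 'I_(N k + p - 2)}.
Definition element := {dffun forall k : 'I_d, 'I_(N k)}.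

Definition mesh_size (k : 'I_d) : R := (N k)%:R^-1.

Definition mesh_h : R := Num.sqrt (\sum_(k < d) mesh_size k ^+ 2).

(* partial derivative of multi-order r, on the element e, at x, of the discrete
   function with coefficients c *)
Definition discrete_fun (r : 'I_d -> nat) (c : dof -> R) (e : element)
    (x : 'I_d -> R) : R :=
  \sum_(s : dof) c s *
    \prod_(k < d)
      ((bspline (open_knot R (N k)) p ((s k)%:Z - p%:Z + 1) (e k)%:Z)^`(r k)).[x k].

Definition discrete_val := discrete_fun (fun=> 0%N).
Definition discrete_partial (l : 'I_d) := discrete_fun (fun k => (k == l) : nat).

Definition quad_mesh (f : element -> ('I_d -> R) -> R) : R :=
  \sum_(e : element) \sum_(q : {ffun 'I_d -> 'I_(size (opt_rule R p))})
    (\prod_(k < d) weight_on (opt_rule R p) (mesh_size k) (q k)) *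
    f e (fun k => node_on (opt_rule R p) ((e k)%:R * mesh_size k)
                    (mesh_size k) (q k)).

Definition form_ah (c c' : dof -> R) : R :=
  quad_mesh (fun e x => \sum_(l < d)
    discrete_partial l c e x * discrete_partial l c' e x).

Definition form_bh (c c' : dof -> R) : R :=
  quad_mesh (fun e x => discrete_val c e x * discrete_val c' e x).

Definition zero_coef (c : dof -> R) : Prop := forall s, c s = 0.

Definition discrete_eigenpair (lam : R) (c : dof -> R) : Prop :=
  ~ zero_coef c /\ forall c', form_ah c c' = lam * form_bh c c'.

(* n counts the discrete eigenpairs with multiplicity; it is left free, since
   n = dim V_h would require the quadrature form b_h to be definite. *)
Definition discrete_eigen_listing (n : nat) :
    (nat -> R) -> (nat -> dof -> R) -> Prop :=
  eigen_listing zero_coef discrete_eigenpair (fun i => 1 <= i <= n)%N.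

End discrete_problem.

Section dispersion.
Context (R : realType).

(* r-th derivative of the cardinal B-spline of degree p at x in [e, e + 1] *)
Definition cardinal (p r : nat) (e : int) (x : R) : R :=
  ((bspline (fun i : int => i%:~R) p 0 e)^`(r)).[x].

(* quadrature with O_p on the unit intervals of B^(r)(x) B^(r)(x - m), which
   vanishes outside [0, p + 1]: this is m_m for r = 0 and k_m for r = 1 *)
Definition cardinal_coef (p r : nat) (m : int) : R :=
  \sum_(e < p.+1) \sum_(q < size (opt_rule R p))
    weight_on (opt_rule R p) 1 q *
    let x := node_on (opt_rule R p) e%:R 1 q in
    cardinal p r e%:Z x * cardinal p r (e%:Z - m) (x - m%:~R).

(* sum over |m| <= p, with m written as i - p *)
Definition symbol (p r : nat) (L : R) : R :=
  \sum_(i < (2 * p).+1)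
    let m := i%:Z - p%:Z in cardinal_coef p r m * cos (m%:~R * L).

Definition dispersion1 (p : nat) (h lam : R) : R :=
  let L := Num.sqrt lam * h in
  (h ^+ 2)^-1 * (symbol p 1 L / symbol p 0 L).

(* [val] is a value that the dispersion relation on the mesh N assigns to the
   exact eigenvalue lam = \sum_k pi^2 m_k^2 *)
Definition dispersion_value (d p : nat) (N : 'I_d -> nat) (lam val : R) : Prop :=
  exists m : 'I_d -> nat,
    [/\ forall k, (1 <= m k)%N,
        lam = \sum_(k < d) pi ^+ 2 * (m k)%:R ^+ 2
      & val = \sum_(k < d)
                dispersion1 p (mesh_size R N k) (pi ^+ 2 * (m k)%:R ^+ 2)].

End dispersion.

(* Main.v *)
(** Both rules blended in O_p are exact up to degree 2p - 1, and on degree 2p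
    the rule O_p errs by an explicit multiple of the leading coefficient, which
    comes from the Lobatto part alone: integrating its nodal polynomial
    (X^2 - 1) P_p' by parts reduces the error to the integral of X^p P_p.
    Hence the stencil coefficients k_m and m_m are explicit rationals.

    Let K(L) and M(L) be the sums of k_m cos(m L) and m_m cos(m L).  By Taylor's
    formula, K(L) - L^2 M(L) = O(L^(2p+4)) amounts to p + 2 linear relations
    between the moments of k and those of m, which are checked in exact integer
    arithmetic.  Since cos x >= 1 - x^2 / 2, the inequality
    sum |m_m| m^2 < 2 sum m_m, checked likewise, keeps M away from 0 on [0, 1].
    Dividing by h^2 M(L) with L = sqrt(lam) h gives the bound in one dimension;
    the bounds in the d directions are summed, using h_k <= h and
    lam^(k) <= lam_j. *)
From HB Require Import structures.
From Stdlib Require Import ZArith.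
Require Import Defs.
From mathcomp Require Import all_boot all_order all_algebra.
From mathcomp Require Import polyrcf ssrZ.
From mathcomp Require Import all_classical all_reals all_analysis.
From mathcomp Require Import ring lra zify.

Import Order.TTheory GRing.Theory Num.Theory.
Import numFieldNormedType.Exports.

Local Open Scope ring_scope.

(** * Integration of polynomials and interpolatory rules *)

Section poly_integral.
Context {R : realType}.
Implicit Types f g : {poly R}.

(* The summand of index 0 vanishes because 0^-1 = 0. *)
Definition primitive f : {poly R} := \poly_(i < (size f).+1) (f`_i.-1 / i%:R).

Lemma coef_primitive f i : (primitive f)`_i = f`_i.-1 / i%:R.
Proof.
rewrite coef_poly; case: ltnP => //; case: i => [|i]; first by [].
by move=> h; rewrite nth_default ?mul0r.
Qed.

Lemma deriv_primitive f : (primitive f)^`() = f.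
Proof.
apply/polyP => i; rewrite coef_deriv coef_primitive /= -[LHS]mulr_natr.
by rewrite divfK // pnatr_eq0.
Qed.

Lemma primitive_is_linear : linear primitive.
Proof.
move=> a f g; apply/polyP => i.
by rewrite !(coefD, coefZ, coef_primitive) mulrDl mulrA.
Qed.

HB.instance Definition _ :=
  GRing.isLinear.Build R {poly R} {poly R} _ primitive primitive_is_linear.

(** Algebraic stand-in for the integral over [-1, 1]: linearity and integration by parts become
    polynomial identities, and the Lebesgue integral occurs only in [Rintegral_poly]. *)
Definition integ f : R := (primitive f).[1] - (primitive f).[-1].

Lemma integ_is_linear : linear_for *%R integ.
Proof.
by move=> a f g; rewrite /integ linearP /= !(hornerD, hornerZ); ring.
Qed.

HB.instance Definition _ :=
  GRing.isLinear.Build R {poly R} R _ integ integ_is_linear.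

Lemma deriv0_const f : f^`() = 0 -> f = (f`_0)%:P.
Proof.
move=> f0; apply/polyP => -[|i]; rewrite coefC //=.
have /eqP := congr1 (fun q : {poly R} => q`_i) f0.
by rewrite coef_deriv coef0 mulrn_eq0 => /eqP.
Qed.

Lemma integ_primitive f F : F^`() = f -> integ f = F.[1] - F.[-1].
Proof.
move=> Ff; have : (primitive f - F)^`() = 0.
  by rewrite derivB deriv_primitive Ff subrr.
move=> /deriv0_const/eqP; rewrite subr_eq => /eqP fE.
by rewrite /integ fE !hornerD !hornerC; ring.
Qed.

Lemma integ_by_parts f g :
  integ (f^`() * g) = f.[1] * g.[1] - f.[-1] * g.[-1] - integ (f * g^`()).
Proof.
rewrite -!hornerM -(integ_primitive _ _ (derivM f g)) linearD /=.
by rewrite addrK.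
Qed.

Lemma Rintegral_poly f :
  \int[lebesgue_measure]_(t in `[-1, 1]) f.[t] = integ f.
Proof.
rewrite /Rintegral (@continuous_FTC2 _ _ (horner (primitive f))) //.
- by apply/continuous_subspaceT; exact: continuous_horner.
- split.
  + by move=> x _; exact: derivable_horner.
  + by apply: cvg_at_right_filter; exact: continuous_horner.
  + by apply: cvg_at_left_filter; exact: continuous_horner.
- by move=> x _; rewrite -derivE deriv_primitive.
Qed.

(** Change of variable from [-1, 1] to [0, 1]: the factor 2 is the Jacobian, and the sum is the
    integral of [f] over [0, 1]. *)
Lemma integ_comp01 f :
  integ (f \Po (2^-1 *: (1 + 'X))) = 2 * \sum_(i < size f) f`_i / i.+1%:R.
Proof.
rewrite (integ_primitive _ (2 *: (primitive f \Po (2^-1 *: (1 + 'X)))));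
  last first.
  rewrite derivZ deriv_comp deriv_primitive derivZ derivD derivC derivX add0r.
  rewrite -mul_polyC -mul_polyC mulrC -mulrA mulr1 -polyCM mulVf ?pnatr_eq0 //.
  by rewrite mulr1.
rewrite !hornerZ !horner_comp !hornerZ !hornerD !hornerX !hornerC -mulrBr.
congr (2 * _); rewrite subrr mulr0 horner_coef0 coef_primitive.
rewrite invr0 mulr0 subr0.
rewrite -[1 + 1]/2 mulVf ?pnatr_eq0 // horner_poly big_ord_recl /= invr0.
by rewrite mulr0 mul0r add0r; apply: eq_bigr => i _; rewrite expr1n mulr1.
Qed.

End poly_integral.

Section interpolatory.
Context {R : realType}.
Implicit Types (f : {poly R}) (s : seq R).

Definition rule_sum (Q : rule R) f := \sum_(z <- Q) z.2 * f.[z.1].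

Lemma horner_lagrange_basis s x y : uniq s -> x \in s -> y \in s ->
  (lagrange_basis s x).[y] = (y == x)%:R.
Proof.
move=> us xs ys; rewrite /lagrange_basis horner_prod.
have [->|yx] := eqVneq y x.
  rewrite big1 // => z zx; rewrite hornerZ hornerXsubC mulVf //.
  by rewrite subr_eq0 eq_sym.
apply/eqP; rewrite prodf_seq_eq0; apply/hasP; exists y => //.
by rewrite yx hornerZ hornerXsubC subrr mulr0 eqxx.
Qed.

Lemma size_lagrange_basis s x : uniq s -> x \in s ->
  (size (lagrange_basis s x) <= size s)%N.
Proof.
move=> us xs; rewrite /lagrange_basis -big_filter.
have -> : size s = (size [seq y <- s | y != x]).+1.
  by rewrite size_filter -(count_predC (pred1 x) s) count_uniq_mem // xs.
elim: [seq y <- s | y != x] => [|y l IH]; first by rewrite big_nil size_poly1.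
rewrite big_cons; apply: leq_trans (size_polyMleq _ _) _.
have h : (size ((x - y)^-1 *: ('X - y%:P)) <= 2)%N.
  by rewrite (leq_trans (size_scale_leq _ _)) // size_XsubC.
by rewrite -subn1 leq_subLR add1n -addn2 addnC leq_add.
Qed.

(** The difference of the two sides vanishes at every node, and its degree is less than the number
    of nodes. *)
Lemma lagrange_interpolation s f : uniq s -> (size f <= size s)%N ->
  f = \sum_(x <- s) f.[x] *: lagrange_basis s x.
Proof.
move=> us fs; apply/eqP; rewrite -subr_eq0; apply/eqP.
apply: (@roots_geq_poly_eq0 _ _ s) => //.
  apply/allP => y ys; rewrite rootE hornerD hornerN horner_sum subr_eq0.
  rewrite (bigD1_seq y) //= big1_seq ?addr0.
    by rewrite hornerZ horner_lagrange_basis // eqxx mulr1.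
  move=> x /andP[xy xs]; rewrite hornerZ horner_lagrange_basis //.
  by rewrite eq_sym (negPf xy) mulr0.
apply: leq_trans (size_polyD _ _) _; rewrite size_polyN geq_max fs /=.
rewrite big_seq; elim/big_ind : _ => [|a b ha hb|x xs].
- by rewrite size_poly0.
- by apply: leq_trans (size_polyD _ _) _; rewrite geq_max ha hb.
- exact: leq_trans (size_scale_leq _ _) (size_lagrange_basis _ _ us xs).
Qed.

(** At the nodes [f] agrees with its remainder modulo the nodal polynomial, and this remainder is
    its own interpolant. The error of the rule is thus the integral of a multiple of the nodal
    polynomial. *)
Lemma rule_sum_interpolatory s f : uniq s ->
  rule_sum (interpolatory_rule s) f = integ (f %% \prod_(x <- s) ('X - x%:P)).
Proof.
move=> us; set w := \prod_(x <- s) _.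
have w0 : w != 0 by rewrite monic_neq0 // monic_prod_XsubC.
have fs : (size (f %% w)%R <= size s)%N.
  by rewrite -ltnS -(size_prod_XsubC s id) ltn_modp.
rewrite [in RHS](lagrange_interpolation _ _ us fs) linear_sum /=.
rewrite /rule_sum /interpolatory_rule big_map big_seq [RHS]big_seq.
apply: eq_bigr => x xs; rewrite /= Rintegral_poly linearZ /= mulrC.
congr (_ * _).
have wx : w.[x] = 0 by apply/eqP; rewrite -rootE /w root_prod_XsubC.
by rewrite {1}(divp_eq f w) hornerD hornerM wx mulr0 add0r.
Qed.

End interpolatory.

(** * Roots of the Legendre polynomials and of their derivatives *)

Section legendre_roots.
Context {R : realType}.
Implicit Types (f q : {poly R}) (s : seq R).

(** Rolle's theorem between consecutive roots. The last clause keeps the new roots strictly below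
    the last old one, so that they stay inside (-1, 1) in the applications. *)
Lemma deriv_roots f x s : all (root f) (x :: s) -> path <%R x s ->
  exists s', [/\ all (root f^`()) s', path <%R x s', size s' = size s
    & all (fun y => y < last x s) s'].
Proof.
elim: s x => [|y s IH] x; first by exists [::].
move=> /= /andP[/rootP fx fys] /andP[xy ys].
have /rootP fy : root f y by case/andP: fys.
have [s' [fs' ys' ss' s'l]] := IH y fys ys.
have /= [c] := poly_rolle xy (etrans fx (esym fy)).
rewrite in_itv /= => /andP[xc cy] fc.
have yl : y <= last y s.
  case: (s) ys => [//|z r] /= /andP[yz zr]; apply/ltW/(lt_le_trans yz).
  by have := mem_last z r; rewrite in_cons => /orP[/eqP ->//|h];
    apply/ltW/(allP (order_path_min lt_trans zr)).
exists (c :: s'); split => /=.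
- by rewrite fs' andbT; apply/rootP.
- by rewrite xc (path_le lt_trans cy).
- by rewrite ss'.
- by rewrite (lt_le_trans cy yl).
Qed.

(** A polynomial of degree n has at most n roots, so n distinct known ones exhaust [rootsR f]. *)
Lemma perm_rootsR f s : f != 0 -> uniq s -> all (root f) s ->
  size f = (size s).+1 -> perm_eq (rootsR f) s.
Proof.
move=> f0 us fs sf.
apply: uniq_perm => //; first exact: lt_sorted_uniq (sorted_roots _ _ _).
move=> x; have := roots_on_rootsR f0 x; rewrite in_itv /= => <-.
rewrite [in LHS](all_roots_prod_XsubC sf fs) ?uniq_rootsE //.
by rewrite rootZ ?lead_coef_eq0 // root_prod_XsubC.
Qed.

(** Each differentiation lowers the multiplicity of a root by at most one. *)
Lemma dvdp_XsubC_exp_derivn (a : R) n k f : ('X - a%:P) ^+ (n + k) %| f ->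
  ('X - a%:P) ^+ n %| f^`(k).
Proof.
elim: k f => [|k IH] f; first by rewrite addn0.
rewrite addnS derivSn => /dvdpP[q ->]; apply: IH.
rewrite derivM deriv_exp derivXsubC mul1r /= -mulr_natr exprS.
apply: dvdp_add; apply: dvdp_mull; [exact: dvdp_mulIr|exact: dvdp_mulIl].
Qed.

Lemma root_derivn_sqrX_sub1 m k : (k < m)%N ->
  root ((('X^2 - 1 : {poly R}) ^+ m)^`(k)) 1 /\
  root ((('X^2 - 1 : {poly R}) ^+ m)^`(k)) (-1).
Proof.
move=> km; have E : 'X^2 - 1 = ('X - 1%:P) * ('X - (-1)%:P) :> {poly R}.
  by rewrite polyCN; ring.
have H (a : R) : ('X - a%:P) ^+ m %| ('X^2 - 1) ^+ m ->
    root ((('X^2 - 1) ^+ m)^`(k)) a.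
  move=> h; rewrite -dvdp_XsubCl -[_ - _]expr1; apply: dvdp_XsubC_exp_derivn.
  by apply: dvdp_trans h; rewrite dvdp_exp2l.
by split; apply: H; rewrite E dvdp_exp2r // ?dvdp_mulIl ?dvdp_mulIr.
Qed.

(** Induction on [k]: for k < m the end points -1 and 1 are roots as well, and Rolle's theorem turns
    the resulting k + 2 roots into k + 1 interior roots of the next derivative. *)
Lemma derivn_sqrX_sub1_roots m k : (k <= m)%N -> exists s,
  [/\ all (root ((('X^2 - 1 : {poly R}) ^+ m)^`(k))) s,
      path <%R (-1) (rcons s 1) & size s = k].
Proof.
elim: k => [|k IH] km.
  by exists [::]; split => //=; rewrite andbT -subr_gt0; lra.
have [s [fs ps ss]] := IH (ltnW km).
have [r1 rN1] := root_derivn_sqrX_sub1 _ _ km.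
have frs : all (root ((('X^2 - 1 : {poly R}) ^+ m)^`(k))) (-1 :: rcons s 1).
  by rewrite /= rN1 all_rcons r1.
have [s' [fs' ps' ss' ls']] := deriv_roots _ _ _ frs ps.
exists s'; split; rewrite ?derivnS //; last by rewrite ss' size_rcons ss.
rewrite rcons_path ps' /=; move: ls'; rewrite last_rcons => /allP h.
by have := mem_last (-1) s'; rewrite in_cons => /orP[/eqP ->|/h //]; lra.
Qed.

Lemma size_sqrX_sub1_exp m : size (('X^2 - 1 : {poly R}) ^+ m) = (2 * m).+1.
Proof.
have h : ('X^2 - 1 : {poly R}) \is monic by rewrite monicXnsubC.
rewrite -[LHS]prednK ?size_exp ?size_XnsubC //.
by rewrite size_poly_gt0 monic_neq0 // monic_exp.
Qed.

Lemma size_derivn f k : size f^`(k) = (size f - k)%N.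
Proof.
elim: k => [|k IH]; first by rewrite subn0.
by rewrite derivnS polyorder.size_deriv IH subnS.
Qed.

Lemma legendre_scale_neq0 m : ((2 : R) ^+ m * m`!%:R)^-1 != 0.
Proof.
by rewrite invr_eq0 mulf_neq0 ?expf_neq0 ?pnatr_eq0 // -lt0n fact_gt0.
Qed.

Lemma size_legendre m : size (legendre R m) = m.+1.
Proof.
rewrite size_scale ?legendre_scale_neq0 // size_derivn size_sqrX_sub1_exp.
by rewrite mul2n -addnn -addSn addnK.
Qed.

Lemma legendre_neq0 m : legendre R m != 0.
Proof. by rewrite -size_poly_gt0 size_legendre. Qed.

Lemma legendre_roots m : exists s,
  [/\ all (root (legendre R m)) s, path <%R (-1) (rcons s 1) & size s = m].
Proof.
have [s [fs ps ss]] := derivn_sqrX_sub1_roots _ _ (leqnn m).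
exists s; split => //; apply/allP => x /(allP fs).
by rewrite /legendre rootZ // legendre_scale_neq0.
Qed.

Lemma uniq_rootsR f : uniq (rootsR f).
Proof. exact: lt_sorted_uniq (sorted_roots _ _ _). Qed.

Lemma prod_rootsR f s : f != 0 -> uniq s -> all (root f) s ->
  size f = (size s).+1 ->
  f = lead_coef f *: \prod_(x <- rootsR f) ('X - x%:P).
Proof.
move=> f0 us fs sf; rewrite (perm_big _ (perm_rootsR _ _ f0 us fs sf)).
by rewrite /= -all_roots_prod_XsubC // uniq_rootsE.
Qed.

Lemma legendre_prod m :
  legendre R m = lead_coef (legendre R m) *:
    \prod_(x <- rootsR (legendre R m)) ('X - x%:P).
Proof.
have [s [fs ps ss]] := legendre_roots m.
apply: prod_rootsR fs _; rewrite ?legendre_neq0 ?size_legendre ?ss //.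
by move: ps; rewrite rcons_path => /andP[/path_sorted/lt_sorted_uniq].
Qed.

(** Rolle's theorem places [p] roots of the derivative strictly between the roots of the Legendre
    polynomial, hence inside (-1, 1). They are therefore all its roots, and distinct from the two
    end points that the Lobatto rule adds. *)
Lemma deriv_legendre_prod p (Lp := (legendre R p.+1)^`()) :
  Lp = lead_coef Lp *: \prod_(x <- rootsR Lp) ('X - x%:P) /\
  uniq (-1 :: rcons (rootsR Lp) 1).
Proof.
have [[|x s] [fs ps ss]] := legendre_roots p.+1; first by [].
case: ss => ss.
have [xs /= xN] : path <%R x s /\ -1 < x.
  by move: ps => /= /andP[-> ]; rewrite rcons_path => /andP[].
have [s' [fs' ps' ss' ls']] := deriv_roots _ _ _ fs xs.
have us' : uniq s' by exact: lt_sorted_uniq (path_sorted ps').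
have sL : size Lp = (size s').+1.
  by rewrite /Lp polyorder.size_deriv size_legendre ss' ss.
have L0 : Lp != 0 by rewrite -size_poly_gt0 sL.
split; first exact: (prod_rootsR _ _ L0 us' fs' sL).
rewrite /= mem_rcons in_cons rcons_uniq uniq_rootsR.
rewrite !(perm_mem (perm_rootsR _ _ L0 us' fs' sL)) andbT.
apply/andP; split.
  apply/norP; split; first by rewrite eq_sym gt_eqF //; lra.
  apply/negP => /(allP (order_path_min lt_trans ps')) /(lt_trans xN).
  by rewrite ltxx.
apply/negP => /(allP ls'); move: ps; rewrite /= rcons_path => /and3P[_ _ h].
by rewrite ltNge ltW.
Qed.

End legendre_roots.

(** * Defect of the Gauss-Legendre and Gauss-Lobatto rules *)

Section legendre_orthogonality.
Context {R : realType}.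
Implicit Types (f q : {poly R}).

(** Repeated integration by parts; the boundary terms vanish because derivatives of order below [m]
    have -1 and 1 as roots. *)
Lemma integ_derivn_sqrX_sub1 m k q : (k <= m)%N ->
  integ ((('X^2 - 1) ^+ m)^`(k) * q) =
  (-1) ^+ k * integ (('X^2 - 1) ^+ m * q^`(k)).
Proof.
elim: k q => [|k IH] q km; first by rewrite mul1r.
rewrite derivnS integ_by_parts (IH _ (ltnW km)) derivSn.
have [/rootP -> /rootP ->] := root_derivn_sqrX_sub1 (R := R) _ _ km.
by rewrite [(-1) ^+ k.+1]exprS; ring.
Qed.

(** Write I_m for the integral of (X^2 - 1)^m. Integrating the derivative of X (X^2 - 1)^(m+1),
    which is zero at both end points, gives (2m + 3) I_(m+1) = - (2m + 2) I_m. *)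
Lemma integ_sqrX_sub1_exp m :
  (-1) ^+ m * integ (('X^2 - 1) ^+ m) =
  2 ^+ (2 * m).+1 * m`!%:R ^+ 2 / (2 * m).+1`!%:R :> R.
Proof.
elim: m => [|m IH].
  rewrite !expr0 (integ_primitive _ 'X) ?derivX // !hornerX.
  rewrite mul1r muln0 !fact0 divr1 expr1n expr1; ring.
have := integ_primitive _ _ (erefl ('X * ('X^2 - 1 : {poly R}) ^+ m.+1)^`()).
rewrite !hornerM !horner_exp !hornerD !hornerN !hornerXn !hornerC expr1n sqrrN.
rewrite expr1n subrr expr0n !mulr0 subr0 derivM derivX mul1r deriv_exp /=.
rewrite derivB derivXn derivC subr0 /= expr1.
have -> : 'X * ('X *+ 2 * ('X^2 - 1) ^+ m *+ m.+1) =
    (2 * m.+1%:R) *: (('X^2 - 1) ^+ m.+1 + ('X^2 - 1) ^+ m) :> {poly R}.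
  rewrite -mul_polyC polyCM !polyC_natr -[in LHS]mulrnAr -[_ *+ m.+1]mulr_natr.
  by rewrite [_ ^+ m.+1]exprS; ring.
rewrite scalerDr !linearD !linearZ /= => E.
have {}E : (2 * m.+1).+1%:R * integ (('X^2 - 1) ^+ m.+1) =
    - (2 * m.+1%:R * integ (('X^2 - 1) ^+ m)) :> R.
  by rewrite -[(2 * m.+1).+1]addn1 natrD natrM; move: E; lra.
have n0 : (2 * m.+1).+1%:R != 0 :> R by rewrite pnatr_eq0.
apply: (mulfI n0); rewrite mulrCA E exprS mulN1r mulrN mulNr opprK mulrCA IH.
have -> : (2 * m.+1 = (2 * m).+2)%N by rewrite mulnS in n0 *.
have f0 : (2 * m).+1`!%:R != 0 :> R by rewrite pnatr_eq0 -lt0n fact_gt0.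
rewrite (factS (2 * m).+2) (factS (2 * m).+1) (factS m).
have e : ((2 * m).+2)%:R = 2 * m.+1%:R :> R by rewrite -natrM mulnS.
have a0 : m.+1%:R != 0 :> R by rewrite pnatr_eq0.
have b0 : (2 * m).+3%:R != 0 :> R by rewrite pnatr_eq0.
move: (2 * m).+1`! m`! f0 => z y z0; rewrite !natrM e !exprS !expr0.
move: (2 ^+ (2 * m)) m.+1%:R (2 * m).+3%:R a0 b0 => x a b a0 b0.
by field; rewrite a0 b0 z0.
Qed.

(** By Rodrigues' formula, [m] integrations by parts move all derivatives onto [q], leaving the
    constant q_m m!. For deg q < m this is orthogonality. *)
Lemma integ_legendre_mul m q : (size q <= m.+1)%N ->
  integ (legendre R m * q) =
  q`_m * (2 ^+ m.+1 * m`!%:R ^+ 2 / (2 * m).+1`!%:R).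
Proof.
move=> sq; rewrite /legendre -scalerAl linearZ /= integ_derivn_sqrX_sub1 //.
have -> : q^`(m) = (q`_m * m`!%:R)%:P.
  apply/polyP => i; rewrite coef_derivn coefC; case: i => [|i] /=.
    by rewrite addn0 ffactnn mulr_natr.
  by rewrite nth_default ?mul0rn // (leq_trans sq) // addnS ltnS leq_addr.
rewrite [_ * _%:P]mulrC mul_polyC linearZ /= [(-1) ^+ m * _]mulrCA.
rewrite integ_sqrX_sub1_exp.
have f0 : m`!%:R != 0 :> R by rewrite pnatr_eq0 -lt0n fact_gt0.
have g0 : (2 * m).+1`!%:R != 0 :> R by rewrite pnatr_eq0 -lt0n fact_gt0.
have h0 : (2 : R) ^+ m != 0 by rewrite expf_neq0 // pnatr_eq0.
have -> : 2 ^+ (2 * m).+1 = 2 * (2 ^+ m * 2 ^+ m) :> R.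
  by rewrite exprS mul2n -addnn exprD.
rewrite [2 ^+ m.+1]exprS; move: (2 * m).+1`! m`! (2 ^+ m) f0 g0 h0 => z y x *.
by field; apply/and3P.
Qed.

Lemma lead_coef_legendre m :
  lead_coef (legendre R m) = (2 * m)`!%:R / (2 ^+ m * m`!%:R ^+ 2).
Proof.
have f0 : m`!%:R != 0 :> R by rewrite pnatr_eq0 -lt0n fact_gt0.
have h0 : (2 : R) ^+ m != 0 by rewrite expf_neq0 // pnatr_eq0.
rewrite lead_coefE size_legendre /= coefZ coef_derivn.
have : lead_coef (('X^2 - 1 : {poly R}) ^+ m) = 1.
  by apply/eqP; rewrite -[_ == _]/(_ \is monic) monic_exp // monicXnsubC.
rewrite lead_coefE size_sqrX_sub1_exp /= mul2n -addnn => ->.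
have := ffact_fact (leq_addl m m); rewrite addnK => <-.
by rewrite natrM; field; rewrite f0 h0.
Qed.

Lemma coefM_top f q a b : (size f <= a.+1)%N -> (size q <= b.+1)%N ->
  (f * q)`_(a + b) = f`_a * q`_b.
Proof.
move=> sf sq; have la : (a < (a + b).+1)%N by rewrite ltnS leq_addr.
rewrite coefM (bigD1 (Ordinal la)) //= addKn big1 ?addr0 // => i.
rewrite -val_eqE /= neq_ltn => /orP[ia|ai]; last first.
  by rewrite nth_default ?mul0r // (leq_trans sf).
rewrite [q`__]nth_default ?mulr0 // (leq_trans sq) //.
by move: (val i) ia => j; lia.
Qed.

End legendre_orthogonality.

Section gauss_rules.
Context {R : realType}.
Implicit Types (f q : {poly R}).

Lemma size_lead_coef_scale (g w : {poly R}) :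
  g = lead_coef g *: w -> g != 0 -> size w = size g.
Proof.
by move=> gE g0; rewrite [in RHS]gE size_scale // lead_coef_eq0.
Qed.

(** The quotient of [f] by the nodal polynomial has degree below [m], so it is orthogonal to the
    Legendre polynomial. *)
Lemma gauss_legendre_exact m f : (size f <= 2 * m)%N ->
  rule_sum (gauss_legendre R m) f = integ f.
Proof.
move=> sf; rewrite rule_sum_interpolatory ?uniq_rootsR //.
have L := legendre_prod (R := R) m; have L0 := legendre_neq0 (R := R) m.
set w := \prod_(x <- _) _ in L *.
have sw : size w = m.+1.
  by rewrite (size_lead_coef_scale _ _ L) // size_legendre.
have w0 : w != 0 by rewrite -size_poly_gt0 sw.
rewrite [in RHS](divp_eq f w) linearD /=.
suff -> : integ (f %/ w * w) = 0 by rewrite add0r.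
have sq : (size (f %/ w)%R <= m)%N.
  by rewrite size_divp // sw leq_subLR addnn -mul2n.
have -> : f %/ w * w =
    (lead_coef (legendre R m))^-1 *: (legendre R m * (f %/ w)).
  rewrite [X in _ *: (X * _)]L -scalerAl scalerA mulVf ?lead_coef_eq0 //.
  by rewrite scale1r mulrC.
rewrite linearZ /= integ_legendre_mul; last exact: leq_trans sq _.
by rewrite nth_default // mul0r mulr0.
Qed.

Definition lobatto_defect (p : nat) : R :=
  2 ^+ (2 * p).+1 * p.+1%:R * p`!%:R ^+ 4 /
    (p%:R * (2 * p)`!%:R * (2 * p).+1`!%:R).

(** With q the quotient of [f] by the nodal polynomial, the error is minus the integral of a
    multiple of P_p' q (X^2 - 1). Integration by parts has no boundary terms and leaves P_p against
    a polynomial of degree at most p, of which only the coefficient of X^p counts. *)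
Lemma gauss_lobatto_defect p f : (0 < p)%N -> (size f <= (2 * p).+1)%N ->
  rule_sum (gauss_lobatto R p.+1) f = integ f + f`_(2 * p) * lobatto_defect p.
Proof.
case: p => [//|p] _ sf; rewrite /gauss_lobatto /=.
have [L us] := deriv_legendre_prod (R := R) p.
rewrite rule_sum_interpolatory // big_cons big_rcons /=.
set P := legendre R p.+1 in L us *; set v := \prod_(x <- _) _ in L *.
have sP : size P^`() = p.+1 by rewrite polyorder.size_deriv size_legendre.
have P0 : P^`() != 0 by rewrite -size_poly_gt0 sP.
have sv : size v = p.+1 by rewrite (size_lead_coef_scale _ _ L).
have wE : ('X - (-1)%:P) * (v * ('X - 1%:P)) = ('X^2 - 1) * v :> {poly R}.
  by rewrite polyCN; ring.
set w := _ * (_ * _) in wE *.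
have mw : w \is monic by rewrite !rpredM ?monicXsubC // monic_prod_XsubC.
have sw : size w = p.+3.
  rewrite wE mulrC size_Mmonic ?monicXnsubC // ?size_XnsubC // ?sv ?addn3 //.
  by rewrite -size_poly_gt0 sv.
have w0 : w != 0 by rewrite monic_neq0.
have sq : (size (f %/ w)%R <= p.+1)%N.
  by rewrite size_divp // sw leq_subLR (leq_trans sf) //; lia.
have sr : (size (f %% w)%R <= p.+2)%N by rewrite -ltnS -sw ltn_modp.
(* The remainder has too low a degree to reach X^(2p), so the leading coefficient of [f] is that of
   the quotient, [w] being monic. *)
set q := f %/ w in sq.
have qE : q`_p = f`_(2 * p.+1).
  rewrite [in RHS](divp_eq f w) coefD [X in _ + X]nth_default ?addr0;
    last first.
    by apply: leq_trans sr _; lia.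
  have -> : (2 * p.+1 = p + p.+2)%N by lia.
  rewrite coefM_top ?sw //.
  by move/monicP: mw; rewrite lead_coefE sw /= => ->; rewrite mulr1.
have -> : integ (f %% w) = integ f - integ (q * w).
  by rewrite [in RHS](divp_eq f w) linearD /= addrAC subrr add0r.
congr (_ + _); rewrite -qE.
have -> : q * w = (lead_coef P^`())^-1 *: (P^`() * (q * ('X^2 - 1))).
  rewrite [X in _ *: (X * _)]L -scalerAl scalerA mulVf ?lead_coef_eq0 //.
  by rewrite scale1r wE; ring.
rewrite linearZ /= integ_by_parts.
have h x : x ^+ 2 = 1 -> (q * ('X^2 - 1)).[x] = 0.
  by move=> x2; rewrite hornerM hornerD hornerXn hornerN hornerC x2 subrr mulr0.
rewrite !h ?sqrrN ?expr1n // !mulr0 subrr sub0r integ_legendre_mul; last first.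
  rewrite polyorder.size_deriv -subn1 leq_subLR add1n.
  by apply: leq_trans (size_polyMleq _ _) _; rewrite size_XnsubC // addn3.
have -> : (q * ('X^2 - 1))^`()`_p.+1 = p.+2%:R * q`_p.
  have := coefM_top q ('X^2 - 1) p 2 sq; rewrite addn2 size_XnsubC //.
  rewrite coefD coefXn coefN coefC subr0 mulr1 => h2.
  by rewrite coef_deriv h2 // mulr_natl.
have -> : lead_coef P^`() = p.+1%:R * lead_coef P.
  rewrite !lead_coefE sP size_legendre coef_deriv /= mulr_natl.
  by [].
rewrite lead_coef_legendre /lobatto_defect.
have f0 k : k`!%:R != 0 :> R by rewrite pnatr_eq0 -lt0n fact_gt0.
have h0 : (2 : R) ^+ p.+1 != 0 by rewrite expf_neq0 // pnatr_eq0.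
have -> : 2 ^+ (2 * p.+1).+1 = 2 * (2 ^+ p.+1 * 2 ^+ p.+1) :> R.
  by rewrite exprS mul2n -addnn exprD.
have n0 : p.+1%:R != 0 :> R by rewrite pnatr_eq0.
rewrite [2 ^+ p.+2]exprS.
move: (f0 p.+1) (f0 (2 * p.+1)) (f0 (2 * p.+1).+1) h0 n0.
move: (2 * p.+1).+1`! (2 * p.+1)`! p.+1`! (2 ^+ p.+1) p.+1%:R => a b c x n *.
by field; apply/and5P.
Qed.

End gauss_rules.

(** * The optimally blended rule on [0, 1] *)

Section unit_interval_rule.
Context {R : realType}.
Implicit Types f : {poly R}.

Lemma rule_sum_blend (tau : R) Q1 Q2 f :
  rule_sum (blend tau Q1 Q2) f =
  tau * rule_sum Q1 f + (1 - tau) * rule_sum Q2 f.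
Proof.
rewrite /rule_sum big_cat !big_map !mulr_sumr /=.
by congr (_ + _); apply: eq_bigr => z _; rewrite mulrA.
Qed.

Lemma rule_sum_opt_rule p f : (0 < p)%N -> (size f <= (2 * p).+1)%N ->
  rule_sum (opt_rule R p) f =
  integ f + (1 - opt_tau R p) * (f`_(2 * p) * lobatto_defect p).
Proof.
move=> p0 sf; rewrite rule_sum_blend gauss_lobatto_defect //.
by rewrite gauss_legendre_exact ?mulnS ?add2n 1?ltnW //; ring.
Qed.

(** [lobatto_defect] weighted by 1 - tau and carried to [0, 1]: the substitution divides the leading
    coefficient by 2^(2p) and the Jacobian halves the integral, which cancels the power of 2. *)
Definition unit_defect (p : nat) : R :=
  (1 - opt_tau R p) * (p.+1%:R * p`!%:R ^+ 4) /
    (p%:R * (2 * p)`!%:R * (2 * p).+1`!%:R).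

(** Lower powers do not reach degree [n], so only the leading term contributes. *)
Lemma coef_comp_unit f n : (size f <= n.+1)%N ->
  (f \Po (2^-1 *: (1 + 'X)))`_n = f`_n / 2 ^+ n.
Proof.
move=> sf; rewrite poly.coef_comp_poly.
have E i : ((2^-1 *: (1 + 'X) : {poly R}) ^+ i)`_n =
    if (i < n)%N then 0 else (2^-1) ^+ i * (('X - (-1)%:P) ^+ i)`_n.
  rewrite exprZn coefZ polyCN opprK [1 + _]addrC; case: ltnP => // ni.
  rewrite [X in _ * X]nth_default ?mulr0 //.
  have -> : 'X + 1%:P = 'X - (-1)%:P :> {poly R} by rewrite polyCN opprK.
  by rewrite size_exp_XsubC.
have [sn|sn] := leqP (size f) n.
  rewrite nth_default // mul0r big1 // => i _.
  by rewrite E (leq_trans (ltn_ord i) sn) mulr0.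
have fn : size f = n.+1 by apply/eqP; rewrite eqn_leq sf.
rewrite fn big_ord_recr /= big1 ?add0r => [|i _]; last first.
  by rewrite E ltn_ord mulr0.
rewrite E ltnn exprVn.
have := monic_exp n (monicXsubC (-1 : R)).
by move/monicP; rewrite lead_coefE size_exp_XsubC /= => ->; rewrite mulr1.
Qed.

Lemma unit_rule p f : (0 < p)%N -> (size f <= (2 * p).+1)%N ->
  \sum_(q < size (opt_rule R p)) weight_on (opt_rule R p) 1 q *
     f.[node_on (opt_rule R p) 0 1 q] =
  \sum_(i < (2 * p).+1) f`_i / i.+1%:R + f`_(2 * p) * unit_defect p.
Proof.
move=> p0 sf; pose g := f \Po (2^-1 *: (1 + 'X)).
have s2 : size (2^-1 *: (1 + 'X) : {poly R}) = 2.
  have -> : 1 + 'X = 'X - (-1)%:P :> {poly R} by rewrite polyCN opprK addrC.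
  by rewrite size_scale ?size_XsubC // invr_eq0 pnatr_eq0.
transitivity (2^-1 * rule_sum (opt_rule R p) g).
  rewrite /rule_sum (big_nth (0, 0)) big_mkord mulr_sumr; apply: eq_bigr => q _.
  rewrite /weight_on /node_on horner_comp hornerZ hornerD hornerX hornerC.
  rewrite !mul1r add0r [RHS]mulrA.
  by rewrite [(1 + _) / 2]mulrC.
rewrite rule_sum_opt_rule ?size_comp_poly2 // integ_comp01 coef_comp_unit //.
rewrite mulrDr mulKf ?pnatr_eq0 //; congr (_ + _).
  rewrite (big_ord_widen _ (fun i => f`_i / i.+1%:R) sf) big_mkcond /=.
  apply: eq_bigr => i _; case: ltnP => // si.
  by rewrite nth_default // mul0r.
rewrite /unit_defect /lobatto_defect.
have f0 k : k`!%:R != 0 :> R by rewrite pnatr_eq0 -lt0n fact_gt0.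
have h0 : (2 : R) ^+ (2 * p) != 0 by rewrite expf_neq0 // pnatr_eq0.
have n0 : p%:R != 0 :> R by rewrite pnatr_eq0 -lt0n.
rewrite [2 ^+ _.+1]exprS; move: (f0 (2 * p)%N) (f0 (2 * p).+1) h0 n0.
move: (2 * p).+1`! (2 * p)`! (2 ^+ (2 * p)) p%:R p.+1%:R => a b x n n' *.
by field; apply/and4P.
Qed.

End unit_interval_rule.

(** * Computable polynomials with integer coefficients *)

Section integer_polynomials.

(* Polynomials are lists of coefficients by increasing degree, so that they
   compute. *)
Fixpoint addp (s t : seq Z) : seq Z :=
  match s, t with
  | x :: s', y :: t' => x + y :: addp s' t'
  | [::], _ => t
  | _, [::] => s
  end.

Fixpoint mulp (s t : seq Z) : seq Z :=
  if s is x :: s' then addp [seq x * y | y <- t] (0 :: mulp s' t) else [::].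

(** Leibniz rule (x + X s)' = s + X s', which needs no degree counter. *)
Fixpoint derivp (s : seq Z) : seq Z :=
  if s is _ :: s' then addp s' (0 :: derivp s') else [::].

Context {R : realType}.

Definition ofZ : Z -> R := intr \o int_of_Z.

HB.instance Definition _ := GRing.RMorphism.copy ofZ (intr \o int_of_Z).

Lemma ofZD x y : ofZ (x + y) = ofZ x + ofZ y. Proof. exact: rmorphD. Qed.
Lemma ofZB x y : ofZ (x - y) = ofZ x - ofZ y. Proof. exact: rmorphB. Qed.
Lemma ofZM x y : ofZ (x * y) = ofZ x * ofZ y. Proof. exact: rmorphM. Qed.
Lemma ofZX x n : ofZ (x ^+ n) = ofZ x ^+ n. Proof. exact: rmorphXn. Qed.
Lemma ofZn n : ofZ n%:R = n%:R. Proof. exact: rmorph_nat. Qed.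

Lemma normr_ofZ z : `|ofZ z| = ofZ `|z|.
Proof. by rewrite /ofZ /= -intr_norm; congr _%:~R; case: z => //= z; lia. Qed.

Lemma ltr_ofZ z z' : (ofZ z < ofZ z') = (z < z').
Proof.
rewrite -subr_gt0 -rmorphB -[RHS]subr_gt0 /ofZ /= ltr0z.
by case: (z' - z) => //= n; lia.
Qed.

Lemma ofZ_eq0 z : (ofZ z == 0) = (z == 0).
Proof. by rewrite /ofZ /= intr_eq0 -[0]/(int_of_Z 0) (can_eq int_of_ZK). Qed.

Definition polyZ (s : seq Z) : {poly R} := Poly [seq ofZ z | z <- s].

Lemma polyZ_cons x s : polyZ (x :: s) = polyZ s * 'X + (ofZ x)%:P.
Proof. by rewrite /polyZ /= cons_poly_def. Qed.

Lemma polyZ_nil : polyZ [::] = 0. Proof. by []. Qed.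

Lemma coef_polyZ s i : (polyZ s)`_i = ofZ s`_i.
Proof.
rewrite coef_Poly; have [h|h] := ltnP i (size s); first by rewrite (nth_map 0).
by rewrite !nth_default ?size_map ?rmorph0.
Qed.

Lemma polyZ_add s t : polyZ (addp s t) = polyZ s + polyZ t.
Proof.
elim: s t => [|x s IH] [|y t]; rewrite ?polyZ_nil ?add0r ?addr0 //=.
by rewrite !polyZ_cons IH rmorphD polyCD; ring.
Qed.

Lemma polyZ_mul s t : polyZ (mulp s t) = polyZ s * polyZ t.
Proof.
elim: s => [|x s IH]; rewrite ?polyZ_nil ?mul0r //=.
rewrite polyZ_add !polyZ_cons IH rmorph0.
suff -> : polyZ [seq x * y | y <- t] = (ofZ x)%:P * polyZ t by ring.
apply/polyP => i; rewrite coefCM !coef_polyZ -rmorphM; congr ofZ.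
have [h|h] := ltnP i (size t); first by rewrite (nth_map 0).
by rewrite !nth_default ?size_map ?mulr0.
Qed.

Lemma polyZ_deriv s : polyZ (derivp s) = (polyZ s)^`().
Proof.
elim: s => [|x s IH]; rewrite ?polyZ_nil ?deriv0 //= polyZ_add !polyZ_cons IH.
by rewrite rmorph0 derivD derivM derivX derivC; ring.
Qed.

Lemma polyZ_derivn r s : polyZ (iter r derivp s) = (polyZ s)^`(r).
Proof. by elim: r => // r IH; rewrite iterS polyZ_deriv IH. Qed.

End integer_polynomials.

(** * Stencil coefficients as integers *)

Section integer_symbols.

(* Coefficients, by increasing degree in s, of q! times the cardinal B-spline of
   degree q at j + s, 0 <= s <= 1. *)
Fixpoint piece (q : nat) (j : Z) : seq Z :=
  if q is q'.+1 then
    addp (mulp [:: j; 1] (piece q' j))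
         (mulp [:: q'%:R + 2 - j; -1] (piece q' (j - 1)))
  else if j == 0 then [:: 1] else [::].

Lemma pieceS q j : piece q.+1 j =
  addp (mulp [:: j; 1] (piece q j))
       (mulp [:: q%:R + 2 - j; -1] (piece q (j - 1))).
Proof. by []. Qed.

(* Numerator and denominator of [opt_tau p], in an arbitrary ring: comparing
   integer and real values through abstract morphisms spares conversion from
   computing large unary numerals. *)
Definition tau_frac (A : pzRingType) (p : nat) : A * A :=
  match p with
  | 1 => (1, 2)
  | 2 => (1, 3)
  | 3 => (- 3, 2)
  | 4 => (- 79, 5)
  | 5 => (- 174, 1)
  | 6 => (- (91 * 10 ^+ 3 + 177), 35)
  | 7 => (- (105 * 10 ^+ 3 + 103), 2)
  | _ => (0, 1)
  end.

Lemma rmorph_tau_frac (A B : pzRingType) (f : {rmorphism A -> B}) p :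
  f (tau_frac A p).1 = (tau_frac B p).1 /\
  f (tau_frac A p).2 = (tau_frac B p).2.
Proof.
case: p => [|[|[|[|[|[|[|[|p]]]]]]]]; rewrite /tau_frac; cbn [fst snd].
- by rewrite rmorph0 rmorph1.
- by rewrite rmorph1 rmorph_nat.
- by rewrite rmorph1 rmorph_nat.
- by rewrite rmorphN !rmorph_nat.
- by rewrite rmorphN !rmorph_nat.
- by rewrite rmorphN rmorph_nat rmorph1.
- by rewrite rmorphN rmorphD rmorphM rmorphXn !rmorph_nat.
- by rewrite rmorphN rmorphD rmorphM rmorphXn !rmorph_nat.
- by rewrite rmorph0 rmorph1.
Qed.

Fixpoint factZ (n : nat) : Z := if n is n'.+1 then n%:R * factZ n' else 1.

(* A common denominator of 1, 1/2, ..., 1/(2p + 1) and [unit_defect p], hence of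
   all values of the rule O_p on [0, 1] at integer polynomials. *)
Definition unit_scale (p : nat) : Z :=
  (tau_frac Z p).2 * (p%:R * factZ (2 * p) * factZ (2 * p).+1).

(** The product of [unit_scale p] and [unit_defect p]. *)
Definition unit_defectZ (p : nat) : Z :=
  ((tau_frac Z p).2 - (tau_frac Z p).1) * (p.+1%:R * factZ p ^+ 4).

Definition sumZ (s : seq Z) : Z := foldr +%R 0 s.

Definition unit_ruleZ (p : nat) (s : seq Z) : Z :=
  sumZ [seq s`_i * Z.div (unit_scale p) i.+1%:R | i <- iota 0 (2 * p).+1] +
  s`_(2 * p) * unit_defectZ p.

(* [cardinal_coef p r (i - p)] times [unit_scale p * p!^2]. *)
Definition symbolZ (p r i : nat) : Z :=
  sumZ [seq unit_ruleZ p
    (mulp (iter r derivp (piece p (Z_of_int e%:Z)))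
          (iter r derivp (piece p (Z_of_int (e%:Z - (i%:Z - p%:Z))))))
    | e <- iota 0 p.+1].

Definition coefsZ (p r : nat) : seq Z := mkseq (symbolZ p r) (2 * p).+1.

Definition momentZ (p : nat) (c : seq Z) (t : nat) : Z :=
  sumZ [seq c`_i * Z_of_int (i%:Z - p%:Z) ^+ t | i <- iota 0 (2 * p).+1].

(** Ensures that the divisions [Z.div] in [unit_ruleZ] are exact. *)
Definition scale_check (p : nat) : bool :=
  (unit_scale p != 0) &&
  all (fun i => Z.div (unit_scale p) i.+1%:R * i.+1%:R == unit_scale p)
    (iota 0 (2 * p).+1).

(** The first two conditions say that K(L) - L^2 M(L) has no term of degree at most 2p + 2: the one
    for [t] compares the coefficients of L^(2t+2). The third is the positivity condition on M. A
    common positive factor of [k] and [mu] does not affect any of them. *)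
Definition moment_check (p : nat) : bool :=
  let k := coefsZ p 1 in
  let mu := coefsZ p 0 in
  [&& momentZ p k 0 == 0,
      all (fun t => momentZ p k (2 * t).+2 +
                    (2 * t).+2%:R * (2 * t).+1%:R * momentZ p mu (2 * t) == 0)
        (iota 0 p.+1)
    & momentZ p [seq `|c| | c <- mu] 2 < 2 * momentZ p mu 0].

Lemma scale_moment_check :
  all (fun p => scale_check p && moment_check p) (iota 1 7).
Proof. by vm_compute. Qed.

End integer_symbols.

Section cardinal_pieces.
Context {R : realType}.

Lemma ofZ_of_int (n : int) : ofZ (Z_of_int n) = n%:~R :> R.
Proof. by rewrite /ofZ /= Z_of_intK. Qed.

Lemma ofZ_factZ n : ofZ (factZ n) = n`!%:R :> R.
Proof.
elim: n => [|n IH]; first by rewrite rmorph1.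
by rewrite /= ofZM ofZn IH factS natrM.
Qed.

Lemma ofZ_sumZ (f : nat -> Z) n :
  ofZ (sumZ [seq f i | i <- iota 0 n]) = \sum_(i < n) ofZ (f i) :> R.
Proof.
rewrite -(big_mkord predT (fun i => ofZ (f i))) /index_iota subn0.
by elim: iota => [|i s IH]; rewrite ?big_nil ?rmorph0 //= big_cons ofZD IH.
Qed.

Lemma size_bspline (t : int -> R) p i k : (size (bspline t p i k) <= p.+1)%N.
Proof.
elim: p i => [|p IH] i /=; first by case: eqP; rewrite ?size_poly1 ?size_poly0.
have H a (c : {poly R}) j : (size c <= 2)%N ->
    (size (a *: (c * bspline t p j k)) <= p.+2)%N.
  move=> sc; apply: leq_trans (size_scale_leq _ _) _.
  apply: leq_trans (size_polyMleq _ _) _.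
  by rewrite -subn1 leq_subLR add1n -add2n leq_add.
apply: leq_trans (size_polyD _ _) _; rewrite geq_max !H //.
  by rewrite -opprB size_polyN size_XsubC.
by rewrite size_XsubC.
Qed.

Definition int_knot (i : int) : R := i%:~R.

(** With integer knots both denominators of the Cox-de Boor recursion at degree p + 1 equal p + 1,
    so they accumulate to a factorial. In the local coordinate of the span, the pieces depend on k -
    i only. *)
Lemma bspline_piece p (i k : int) :
  bspline int_knot p i k \Po ('X + k%:~R%:P) =
  p`!%:R^-1 *: polyZ (piece p (Z_of_int (k - i))).
Proof.
elim: p i => [|p IH] i.
  rewrite invr1 scale1r /=.
  have -> : (Z_of_int (k - i) == 0) = (i == k).
    by rewrite -(can_eq int_of_ZK) Z_of_intK subr_eq0 eq_sym.
  case: eqP => _; last by rewrite comp_poly0 polyZ_nil.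
  by rewrite comp_polyC polyZ_cons polyZ_nil mul0r add0r rmorph1.
have d1 : int_knot (i + p%:Z + 1) - int_knot i = p.+1%:R.
  by rewrite /int_knot !intrD -natr1; ring.
have d2 : int_knot (i + p%:Z + 2) - int_knot (i + 1) = p.+1%:R.
  by rewrite /int_knot !intrD -natr1; ring.
rewrite [bspline _ _ _ _]/= d1 d2 comp_polyD !comp_polyZ !comp_polyM
  !comp_polyB.
rewrite !comp_polyX !comp_polyC !IH pieceS polyZ_add !polyZ_mul.
have -> : Z_of_int (k - (i + 1)) = Z_of_int (k - i) - 1.
  by rewrite opprD addrA [LHS]rmorphB.
set j := Z_of_int (k - i).
have jE : ofZ j = k%:~R - i%:~R :> R by rewrite ofZ_of_int intrB.
have cE : ofZ (p%:R + 2 - j) = p%:R + 2 - (k%:~R - i%:~R) :> R.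
  by rewrite -jE ofZB ofZD !ofZn.
have oneE : ofZ 1 = 1 :> R by rewrite rmorph1.
have N1E : ofZ (-1) = -1 :> R by rewrite rmorphN1.
rewrite !polyZ_cons polyZ_nil !mul0r !add0r jE cE oneE N1E.
rewrite factS natrM invfM !scalerDr -!scalerAr !scalerA.
congr (_ *: (_ * _) + _ *: (_ * _)).
  by rewrite /int_knot polyCB; ring.
rewrite /int_knot !intrD !(polyCD, polyCB, polyCN); ring.
Qed.

Lemma derivn_comp_shift (f : {poly R}) c r :
  (f \Po ('X + c%:P))^`(r) = f^`(r) \Po ('X + c%:P).
Proof.
elim: r => // r IH; rewrite !derivnS IH deriv_comp derivD derivX derivC addr0.
by rewrite mulr1.
Qed.

Lemma cardinal_piece p r (e : int) s :
  cardinal p r e (s + e%:~R) =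
  p`!%:R^-1 * ((polyZ (piece p (Z_of_int e)))^`(r)).[s] :> R.
Proof.
have := bspline_piece p 0 e; rewrite subr0 => /(congr1 (fun f => (f^`(r)).[s])).
rewrite derivn_comp_shift horner_comp hornerD hornerX hornerC.
by rewrite derivnZ hornerZ.
Qed.

Lemma size_piece p r (e : int) :
  (size ((polyZ (piece p (Z_of_int e)))^`(r) : {poly R}) <= p.+1)%N.
Proof.
rewrite size_derivn leq_subLR; apply: leq_trans (leq_addl _ _).
have h0 : p`!%:R^-1 != 0 :> R by rewrite invr_eq0 pnatr_eq0 -lt0n fact_gt0.
have := bspline_piece p 0 e; rewrite subr0.
move=> /(congr1 (fun f => size (polyseq f))).
rewrite size_scale // => <-; rewrite size_comp_poly2 ?size_bspline //.
by rewrite -[_%:P]opprK -polyCN size_XsubC.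
Qed.

Lemma opt_tau_frac p : (1 <= p <= 7)%N ->
  opt_tau R p = (tau_frac R p).1 / (tau_frac R p).2 /\ (tau_frac R p).2 != 0.
Proof.
do 8?[case: p => [|p] //] => _; rewrite /opt_tau /tau_frac; cbn [fst snd];
  split; by rewrite ?pnatr_eq0 ?mulNr // ?divr1 ?oner_eq0.
Qed.

Lemma unit_ruleZE p s : (1 <= p <= 7)%N -> scale_check p ->
  ofZ (unit_ruleZ p s) = ofZ (unit_scale p) *
    (\sum_(i < (2 * p).+1) (polyZ s)`_i / i.+1%:R +
     (polyZ s)`_(2 * p) * unit_defect p) :> R.
Proof.
move=> p17 /andP[_ /allP sc]; rewrite /unit_ruleZ ofZD ofZ_sumZ mulrDr.
congr (_ + _).
  rewrite mulr_sumr; apply: eq_bigr => i _.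
  have /sc/eqP h : (i : nat) \in iota 0 (2 * p).+1.
    by rewrite mem_iota add0n ltn_ord.
  rewrite -{2}h !ofZM ofZn coef_polyZ.
  have : i.+1%:R != 0 :> R by rewrite pnatr_eq0.
    by move: i.+1%:R => n n0; field.
have [tE t0] := opt_tau_frac _ p17.
have [t1 t2] := rmorph_tau_frac _ _ (@ofZ R) p.
rewrite ofZM coef_polyZ mulrCA; congr (_ * _).
rewrite /unit_defectZ /unit_scale /unit_defect tE.
rewrite !(t1, t2, ofZM, ofZB, ofZX, ofZn, ofZ_factZ).
have f0 k : k`!%:R != 0 :> R by rewrite pnatr_eq0 -lt0n fact_gt0.
have p0 : p%:R != 0 :> R by rewrite pnatr_eq0 -lt0n; case/andP: p17.
move: (f0 (2 * p)%N) (f0 (2 * p).+1) p0 t0.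
move: (2 * p).+1`! (2 * p)`! p`! p%:R p.+1%:R (_.2) => a b c n n' d *.
by field; apply/and4P.
Qed.

(** On each unit interval the integrand is a product of two pieces, of degree at most 2p, so
    [unit_rule] evaluates it; each piece contributes one factor 1/p!. *)
Lemma cardinal_coefE p r i : (1 <= p <= 7)%N -> scale_check p ->
  cardinal_coef R p r (i%:Z - p%:Z) =
  ofZ (symbolZ p r i) / (ofZ (unit_scale p) * p`!%:R ^+ 2).
Proof.
move=> p17 sc; have s0 : ofZ (unit_scale p) != 0 :> R.
  by rewrite ofZ_eq0; case/andP: sc.
have f0 : p`!%:R != 0 :> R by rewrite pnatr_eq0 -lt0n fact_gt0.
rewrite /cardinal_coef /symbolZ ofZ_sumZ mulr_suml; apply: eq_bigr => e _.
rewrite unit_ruleZE // polyZ_mul !polyZ_derivn.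
rewrite -unit_rule; last 2 first.
- by case/andP: p17.
- apply: leq_trans (size_polyMleq _ _) _; rewrite -subn1 leq_subLR add1n.
  apply: leq_trans (leq_add (size_piece _ _ e) (size_piece _ _ _)) _.
  by rewrite addSn addnS addnn mul2n.
rewrite [_ / _]mulrAC invfM mulrA divff // mul1r mulr_sumr.
apply: eq_bigr => q _.
rewrite [RHS]mulrCA; congr (_ * _); rewrite hornerM.
have -> : node_on (opt_rule R p) e%:R 1 q =
    node_on (opt_rule R p) 0 1 q + e%:Z%:~R by rewrite /node_on; ring.
rewrite cardinal_piece.
have -> : node_on (opt_rule R p) 0 1 q + e%:Z%:~R - (i%:Z - p%:Z)%:~R =
    node_on (opt_rule R p) 0 1 q + (e%:Z - (i%:Z - p%:Z))%:~R :> R.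
  by rewrite [in RHS]intrB addrA.
by rewrite cardinal_piece /=; field.
Qed.

End cardinal_pieces.

(** * Taylor approximation of cosine sums *)

Section cosine_taylor.
Context {R : realType}.

Definition cos_poly n : {poly R} :=
  \sum_(i < n) ((-1) ^+ i / (2 * i)`!%:R) *: 'X^(2 * i).

Definition sin_poly n : {poly R} :=
  \sum_(i < n) ((-1) ^+ i / (2 * i).+1`!%:R) *: 'X^((2 * i).+1).

Lemma factS_inv (a : R) n : a / n.+1`!%:R *+ n.+1 = a / n`!%:R.
Proof.
rewrite -mulr_natr factS natrM invfM mulrA mulrAC mulrVK //.
by rewrite unitfE pnatr_eq0.
Qed.

Lemma deriv_sin_poly n : (sin_poly n)^`() = cos_poly n.
Proof.
rewrite /sin_poly raddf_sum; apply: eq_bigr => i _.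
by rewrite /= derivZ derivXn -scalerMnr scalerMnl factS_inv.
Qed.

Lemma deriv_cos_poly n : (cos_poly n.+1)^`() = - sin_poly n.
Proof.
rewrite /cos_poly big_ord_recl muln0 expr0 derivD alg_polyC derivC add0r.
rewrite raddf_sum -sumrN; apply: eq_bigr => i _.
rewrite lift0 /= derivZ derivXn -scalerMnr scalerMnl mulnS add2n factS_inv.
by rewrite -scaleNr exprS mulN1r mulNr.
Qed.

Lemma is_derive_horner (f : {poly R}) (x : R) :
  is_derive x (1 : R) (horner f) f^`().[x].
Proof.
by apply: DeriveDef; [exact: derivable_horner | rewrite -derive1E -derivE].
Qed.

(** Mean value theorem between 0 and [x]. The factor 1/(k + 1) that integration would give is
    dropped, which only affects constants. *)
Lemma le_pow_of_derive (f df : R -> R) k :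
  (forall x : R, is_derive x (1 : R) f (df x)) -> f 0 = 0 ->
  (forall x, `|df x| <= `|x| ^+ k) -> forall x, `|f x| <= `|x| ^+ k.+1.
Proof.
move=> fd f0 dfk x.
have cf a b : {within `[a, b], continuous f}%classic.
  apply: derivable_within_continuous => y _; exact: ex_derive.
have H c : `|c| <= `|x| -> f x = df c * x -> `|f x| <= `|x| ^+ k.+1.
  move=> cx ->; rewrite normrM exprSr ler_wpM2r //.
  by apply: le_trans (dfk c) _; rewrite lerXn2r ?nnegrE.
have [x0|x0] := leP 0 x.
  have [c] := MVT_segment x0 (fun y _ => fd y) (cf _ _).
  rewrite in_itv /= f0 !subr0 => /andP[c0 cx]; apply: H.
  by rewrite !ger0_norm.
have [c] := MVT_segment (ltW x0) (fun y _ => fd y) (cf _ _).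
rewrite in_itv /= f0 !sub0r mulrN => /andP[xc c0] /oppr_inj; apply: H.
by rewrite !ler0_norm ?lerN2 // ltW.
Qed.

(** Alternating induction from |cos x| <= 1: the sine remainder has the cosine remainder as
    derivative, and the next cosine remainder has minus the sine remainder. With [n] terms,
    [cos_poly n] stops at degree 2n - 2. *)
Lemma cos_sin_taylor n :
  (forall x, `|cos x - (cos_poly n).[x]| <= `|x| ^+ (2 * n)) /\
  (forall x, `|sin x - (sin_poly n).[x]| <= `|x| ^+ (2 * n).+1).
Proof.
have S m : (forall x, `|cos x - (cos_poly m).[x]| <= `|x| ^+ (2 * m)) ->
    forall x, `|sin x - (sin_poly m).[x]| <= `|x| ^+ (2 * m).+1.
  move=> h; apply: (@le_pow_of_derive _ (fun x => cos x - (cos_poly m).[x])) h.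
    move=> x; rewrite -deriv_sin_poly.
    have := is_derive_horner (sin_poly m) x; exact: is_deriveB.
  rewrite sin0 sub0r horner_sum big1 ?oppr0 // => i _.
  by rewrite hornerZ hornerXn expr0n mulr0.
elim: n => [|n [_ IH]].
  have h x : `|cos x - (cos_poly 0).[x]| <= `|x| ^+ (2 * 0).
    rewrite /cos_poly big_ord0 horner0 subr0 muln0 expr0 ler_norml.
    by rewrite cos_geN1 cos_le1.
  by split => //; exact: S.
suff h : forall x, `|cos x - (cos_poly n.+1).[x]| <= `|x| ^+ (2 * n.+1).
  by split => //; exact: S.
rewrite mulnS add2n.
apply: (@le_pow_of_derive _ (fun x => - sin x - (- sin_poly n).[x])).
- move=> x; rewrite -deriv_cos_poly.
  have := is_derive_horner (cos_poly n.+1) x; exact: is_deriveB.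
- rewrite cos0 horner_sum big_ord_recl big1 ?addr0 => [|i _].
    by rewrite hornerZ hornerXn muln0 !expr0 fact0 divr1 mulr1 subrr.
  by rewrite hornerZ hornerXn expr0n mulr0.
- by move=> x; rewrite hornerN -opprD normrN.
Qed.

(** From cos x = 1 - 2 sin^2 (x/2) and |sin y| <= |y|, the sine estimate with no terms. *)
Lemma cos_lower_bound (x : R) : 1 - x ^+ 2 / 2 <= cos x.
Proof.
have := (cos_sin_taylor 0).2 (x / 2).
rewrite /sin_poly big_ord0 horner0 subr0 muln0 expr1 => h.
have {}h : sin (x / 2) ^+ 2 <= (x / 2) ^+ 2.
  rewrite -[leLHS]real_normK ?num_real // -[leRHS]real_normK ?num_real //.
  by rewrite lerXn2r ?nnegrE.
have -> : cos x = 1 - 2 * sin (x / 2) ^+ 2.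
  rewrite {1}[x]splitr cosD -!expr2 cos2sin2; ring.
by move: h; rewrite expr_div_n; lra.
Qed.

Lemma sum_cos_poly n N (k x : 'I_N -> R) L :
  \sum_i k i * (cos_poly n).[x i * L] =
  \sum_(t < n) (-1) ^+ t / (2 * t)`!%:R * L ^+ (2 * t) *
    (\sum_i k i * x i ^+ (2 * t)).
Proof.
under eq_bigr => i _ do rewrite horner_sum mulr_sumr.
rewrite exchange_big; apply: eq_bigr => t _; rewrite mulr_sumr.
by apply: eq_bigr => i _; rewrite hornerZ hornerXn exprMn; ring.
Qed.

Lemma sum_cos_taylor n N (k x : 'I_N -> R) L : 0 <= L ->
  `|\sum_i k i * cos (x i * L) - \sum_i k i * (cos_poly n).[x i * L]| <=
  (\sum_i `|k i| * `|x i| ^+ (2 * n)) * L ^+ (2 * n).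
Proof.
move=> L0; rewrite -sumrB mulr_suml; apply: le_trans (ler_norm_sum _ _ _) _.
apply: ler_sum => i _; rewrite -mulrBr normrM -mulrA ler_wpM2l //.
apply: le_trans ((cos_sin_taylor n).1 _) _.
by rewrite normrM exprMn (ger0_norm L0).
Qed.

Lemma cos_quotient_bound N p (k mu x : 'I_N -> R) :
  \sum_i k i = 0 ->
  (forall t, (t <= p)%N -> \sum_i k i * x i ^+ (2 * t).+2 +
     (2 * t).+2%:R * (2 * t).+1%:R * \sum_i mu i * x i ^+ (2 * t) = 0) ->
  \sum_i `|mu i| * x i ^+ 2 < 2 * \sum_i mu i ->
  exists2 C, 0 <= C & forall L, 0 <= L <= 1 ->
    `|(\sum_i k i * cos (x i * L)) / (\sum_i mu i * cos (x i * L)) - L ^+ 2| <=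
    C * L ^+ (2 * p.+2).
Proof.
move=> k0 kmu mupos.
(* The lower bound for the denominator on [0, 1] that [cos_lower_bound] provides. *)
pose c := \sum_i mu i - (\sum_i `|mu i| * x i ^+ 2) / 2.
have c0 : 0 < c by rewrite /c; lra.
(* Remainder constants of numerator and denominator; the denominator is expanded to two orders less
   because it gets multiplied by L^2. *)
pose A := \sum_i `|k i| * `|x i| ^+ (2 * p.+2) +
          \sum_i `|mu i| * `|x i| ^+ (2 * p.+1).
have A0 : 0 <= A.
  by rewrite addr_ge0 // sumr_ge0 // => i _; rewrite mulr_ge0 ?exprn_ge0.
exists (A / c); first by rewrite divr_ge0 // ltW.
move=> L /andP[L0 L1].
set K := \sum_i _ * cos _; set M := \sum_i _ * cos _.
have cM : c <= M.
  rewrite /c /M mulr_suml -sumrB; apply: ler_sum => i _.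
  have xL : (x i * L) ^+ 2 <= x i ^+ 2.
    by rewrite exprMn ler_piMr ?sqr_ge0 // exprn_ile1.
  have h1 : `|mu i| * (1 - cos (x i * L)) <= `|mu i| * (x i ^+ 2 / 2).
    by rewrite ler_wpM2l //; have := cos_lower_bound (x i * L); lra.
  have h2 : mu i * (1 - cos (x i * L)) <= `|mu i| * (1 - cos (x i * L)).
    by rewrite ler_wpM2r ?ler_norm // subr_ge0 cos_le1.
  by move: (le_trans h2 h1); rewrite mulrA mulrBr mulr1; lra.
have M0 : 0 < M by exact: lt_le_trans cM.
(* The moment relations match the two Taylor polynomials coefficient by coefficient; the constant
   term on the left is the sum of the [k i], hence 0. *)
have E : \sum_i k i * (cos_poly p.+2).[x i * L] =
    L ^+ 2 * \sum_i mu i * (cos_poly p.+1).[x i * L].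
  rewrite !sum_cos_poly big_ord_recl muln0.
  rewrite [X in _ * X](_ : _ = 0) ?mulr0 ?add0r.
    rewrite mulr_sumr; apply: eq_bigr => t _; rewrite /= mulnS add2n.
    have /eqP := kmu t (ltn_ord t); rewrite addr_eq0 => /eqP ->.
    have f0 : (2 * t)`!%:R != 0 :> R by rewrite pnatr_eq0 -lt0n fact_gt0.
    rewrite !factS !natrM ![in LHS]exprS.
    have : (2 * t).+2%:R != 0 :> R by rewrite pnatr_eq0.
    have : (2 * t).+1%:R != 0 :> R by rewrite pnatr_eq0.
    move: (2 * t)`! f0 (2 * t).+2%:R (2 * t).+1%:R => a a0 b b' b0 b0'.
    by field; rewrite a0 b0 b0'.
  by rewrite -[RHS]k0; apply: eq_bigr => i _; rewrite expr0 mulr1.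
have D : `|K - L ^+ 2 * M| <= A * L ^+ (2 * p.+2).
  have hK := sum_cos_taylor p.+2 _ k x _ L0.
  have hM := sum_cos_taylor p.+1 _ mu x _ L0.
  rewrite -/K -/M E in hK hM.
  set S := \sum_i _ in hK hM *; rewrite -/M in hM.
  have -> : K - L ^+ 2 * M = (K - L ^+ 2 * S) - L ^+ 2 * (M - S) by ring.
  apply: le_trans (ler_normB _ _) _; rewrite /A mulrDl lerD //.
  rewrite normrM ger0_norm ?exprn_ge0 // (mulnS 2 p.+1) exprD mulrCA.
  rewrite ler_wpM2l //.
  exact: exprn_ge0.
have -> : K / M - L ^+ 2 = (K - L ^+ 2 * M) / M by field; rewrite gt_eqF.
rewrite normrM normfV (gtr0_norm M0) [leRHS]mulrAC.
apply: ler_pM => //; first by rewrite invr_ge0 ltW.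
by rewrite lef_pV2.
Qed.

End cosine_taylor.

(** * The dispersion error *)

Lemma momentZE (R : realType) p c (t : nat) :
  ofZ (momentZ p c t) = \sum_(i < (2 * p).+1)
    ofZ c`_i * (i%:Z - p%:Z)%:~R ^+ t :> R.
Proof.
rewrite /momentZ ofZ_sumZ; apply: eq_bigr => i _.
by rewrite ofZM ofZX ofZ_of_int.
Qed.

Lemma dispersion1_bound (R : realType) p : (1 <= p <= 7)%N ->
  exists2 C : R, 0 <= C & forall h lam : R,
    0 < h -> 0 <= lam -> Num.sqrt lam * h < 1 ->
    `|dispersion1 p h lam - lam| <= C * h ^+ (2 * p + 2) * lam ^+ (p + 2).
Proof.
move=> p17.
have /andP[sc /and3P[/eqP k0 /allP kmu mupos]] :
    scale_check p && moment_check p.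
  by have /allP := scale_moment_check; apply; rewrite mem_iota.
pose x (i : 'I_(2 * p).+1) : R := (i%:Z - p%:Z)%:~R.
pose c r (i : 'I_(2 * p).+1) : R := ofZ (symbolZ p r i).
have cE r (i : 'I_(2 * p).+1) : ofZ (coefsZ p r)`_i = c r i.
  by rewrite nth_mkseq.
have [|t tp||C C0 HC] := @cos_quotient_bound R _ p (c 1%N) (c 0%N) x.
- have := momentZE R p (coefsZ p 1) 0; rewrite k0 rmorph0 => E.
  by rewrite [RHS]E; apply: eq_bigr => i _; rewrite cE expr0 mulr1.
- have /kmu/eqP/(congr1 (@ofZ R)) : t \in iota 0 p.+1 by rewrite mem_iota.
  rewrite ofZD !ofZM !ofZn !momentZE rmorph0 => E; rewrite -[RHS]E.
  by congr (_ + _ * _); apply: eq_bigr => i _; rewrite cE.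
- move: mupos; rewrite -(ltr_ofZ (R := R)) ofZM ofZn !momentZE.
  rewrite (eq_bigr (fun i => `|c 0%N i| * x i ^+ 2)) => [|i _]; last first.
    by rewrite (nth_map 0) ?size_mkseq // -normr_ofZ cE.
  rewrite [in X in _ < X -> _](eq_bigr (c 0%N)) // => i _.
  by rewrite expr0 mulr1 cE.
exists C => // h lam h0 lam0 Lh.
have s0 : ofZ (unit_scale p) * p`!%:R ^+ 2 != 0 :> R.
  rewrite mulf_neq0 ?expf_neq0 ?pnatr_eq0 -?lt0n ?fact_gt0 //.
  by rewrite ofZ_eq0; case/andP: sc.
set D := ofZ (unit_scale p) * p`!%:R ^+ 2 in s0.
have symE r L : symbol p r L = D^-1 * \sum_i c r i * cos (x i * L).
  rewrite /symbol mulr_sumr; apply: eq_bigr => i _.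
  by rewrite cardinal_coefE // mulrAC [RHS]mulrC.
rewrite /dispersion1 !symE; set L := Num.sqrt lam * h.
have L0 : 0 <= L by rewrite mulr_ge0 ?sqrtr_ge0 // ltW.
have L01 : 0 <= L <= 1 by rewrite L0 ltW.
(* The common denominator [D] of the stencil coefficients cancels in the quotient. *)
rewrite -mulf_div divff ?invr_eq0 // mul1r.
have L2 : L ^+ 2 = lam * h ^+ 2 by rewrite exprMn sqr_sqrtr.
have hn0 : h ^+ 2 != 0 by rewrite expf_neq0 // gt_eqF.
rewrite -[X in _ - X](mulKf hn0) [h ^+ 2 * lam]mulrC -L2 -mulrBr normrM.
rewrite ger0_norm ?invr_ge0 ?sqr_ge0 //.
rewrite mulrC ler_pdivrMr ?exprn_gt0 //; apply: le_trans (HC _ L01) _.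
(* The last factor h^2 pays for the prefactor 1/h^2 of the dispersion relation. *)
have -> : L ^+ (2 * p.+2) = lam ^+ (p + 2) * (h ^+ (2 * p + 2) * h ^+ 2).
  rewrite exprM L2 exprMn -exprM -exprD addn2 !mulnS -addnA.
  by rewrite [(2 * p + _)%N]addnC.
rewrite [leLHS](_ : _ = C * h ^+ (2 * p + 2) * lam ^+ (p + 2) * h ^+ 2) //.
by move: (h ^+ (2 * p + 2)) (lam ^+ (p + 2)) => a b; ring.
Qed.

Theorem theorem2 (R : realType) (d p j : nat)
    (lam : nat -> R) (u : nat -> d.-tuple R -> R) :
  (1 <= d <= 3)%N -> (1 <= p <= 7)%N -> (1 <= j)%N ->
  exact_eigen_listing lam u ->
  exists C : R,
    forall (N : 'I_d -> nat) (n : nat)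
      (lamh : nat -> R) (uh : nat -> dof p N -> R),
      (forall k, 0 < N k)%N ->
      discrete_eigen_listing n lamh uh ->
      (j <= n)%N ->
      dispersion_value p N (lam j) (lamh j) ->
      Num.max (Num.sqrt (lam j) * mesh_h R N)
              (Num.sqrt (lamh j) * mesh_h R N) < 1 ->
      `|lamh j - lam j| <= C * mesh_h R N ^+ (2 * p + 2) * lam j ^+ (p + 2).
Proof.
move=> _ p17 _ _; have [C C0 HC] := dispersion1_bound R _ p17.
(* [C] serves every mesh size and every one-dimensional eigenvalue, so adding up the directions
   costs only the factor [d]. *)
exists (d%:R * C) => N n lamh uh N0 _ _ [m [_ lamE ->]].
rewrite gt_max => /andP[lamh1 _].
pose l (k : 'I_d) : R := pi ^+ 2 * (m k)%:R ^+ 2.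
have l0 k : 0 <= l k by rewrite mulr_ge0 ?sqr_ge0.
have h0 k : 0 < mesh_size R N k by rewrite invr_gt0 ltr0n.
have le_term (F : 'I_d -> R) k : (forall i, 0 <= F i) -> F k <= \sum_i F i.
  by move=> F0; rewrite (bigD1 k) //= lerDl sumr_ge0.
have hh k : mesh_size R N k <= mesh_h R N.
  rewrite -[leLHS]ger0_norm ?(ltW (h0 k)) // -sqrtr_sqr; apply: ler_wsqrtr.
  by apply: (le_term (fun k => mesh_size R N k ^+ 2)) => i; exact: sqr_ge0.
have ll k : l k <= lam j by rewrite lamE; exact: le_term.
rewrite {1}lamE -sumrB; apply: le_trans (ler_norm_sum _ _ _) _.
rewrite -!mulrA mulr_natl; set B := C * _.
have -> : B *+ d = \sum_(k < d) B by rewrite sumr_const card_ord.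
apply: ler_sum => k _; apply: le_trans (HC _ (l k) (h0 k) (l0 k) _) _.
  apply: le_lt_trans lamh1; apply: ler_pM => //; first exact: ltW.
  exact: ler_wsqrtr.
rewrite -mulrA /B ler_wpM2l //.
have hk := ltW (h0 k); apply: ler_pM; rewrite ?exprn_ge0 //.
  by rewrite lerXn2r ?nnegrE // (le_trans hk).
by rewrite lerXn2r ?nnegrE // (le_trans (l0 k)).
Qed.
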